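(* Let $V=\mathbb{F}_4^2$ be the natural module for $\mathrm{SL}_2(4)$, let $L=\mathrm{ASL}_2(4)=V\rtimes \mathrm{SL}_2(4)$, and let $G$ be the crown-based power $L_2=\{(l_1,l_2)\in L^2\mid l_1V=l_2V\}$ of $L$. Then $G$ is coprimely invariably generated and $d(G)=3$. Moreover, $G$ has a proper subgroup with the same exponent as $G$.
   Context: For a finite group $G$, $d(G)$ denotes the minimal number of generators of $G$. Write $g^x=x^{-1}gx$. A subset $\{g_1,\dots,g_u\}$ of a finite group $G$ invariably generates $G$ if $\{g_1^{x_1},\dots,g_u^{x_u}\}$ generates $G$ for every choice of $x_1,\dots,x_u\in G$. A finite group $G$ is coprimely invariably generated if there is a set $\{g_1,\dots,g_u\}$ that invariably generates $G$ and such that the orders $|g_1|,\dots,|g_u|$ are pairwise coprime. *)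

(* Defs.v *)
From HB Require Import structures.
From mathcomp Require Import all_boot all_order all_algebra.
From mathcomp Require Import all_fingroup all_solvable all_field all_character.

Set Implicit Arguments.
Unset Strict Implicit.
Unset Printing Implicit Defensive.

Import GRing.Theory.
Local Open Scope group_scope.

Section InvariableGeneration.

Variable gT : finGroupType.
Implicit Types (G : {group gT}) (A : {set gT}).

(* [x g] is the conjugator chosen for the element g of A. *)
Definition invariably_generates G A : Prop :=
  A \subset G /\
  forall x : gT -> gT, {in A, forall g, x g \in G} ->
    <<[set g ^ x g | g in A]>> = G.

Definition coprimely_invariably_generated G : Prop :=
  exists A : {set gT},
    invariably_generates G A /\
    {in A &, forall g h, g != h -> coprime #[g] #[h]}.

End InvariableGeneration.

Section CrownBasedSquare.

Variables (gT : finGroupType) (L V : {group gT}).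

Definition crown_square : {set gT * gT} :=
  [set l in setX L L | l.1 *: V == l.2 *: V].

Lemma crown_square_group_set : V <| L -> group_set crown_square.
Proof.
case/andP=> _ nVL; apply/group_setP; split=> [|[a b] [c d]].
  by rewrite !inE !group1 eqxx.
rewrite !inE /= => /andP[/andP[La Lb] /eqP ab] /andP[/andP[Lc Ld] /eqP cd].
have nVd : d \in 'N(V) by apply: (subsetP nVL).
rewrite !groupM //=; apply/eqP.
have -> : (a * c) *: V = a *: V :* d.
  by rewrite lcosetM cd -(norm_rlcoset nVd) mulgA.
by rewrite ab -mulgA (norm_rlcoset nVd) -lcosetM.
Qed.

Definition crown_square_group (nVL : V <| L) : {group gT * gT} :=
  Group (crown_square_group_set nVL).

End CrownBasedSquare.

Section AffineSpecialLinear.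

Variable F : finFieldType.

Definition SL2 : {set {'GL_2[F]}} := [set g | (\det (GLval g) == 1)%R].

Lemma SL2_group_set : group_set SL2.
Proof.
apply/group_setP; split=> [|g h]; first by rewrite inE GL_1E det1.
by rewrite !inE GL_ME det_mulmx => /eqP-> /eqP->; rewrite mulr1.
Qed.

Canonical SL2_group := Group SL2_group_set.

Lemma SL2_sub_GL2 : SL2_group \subset 'GL_2[F].
Proof. exact: subsetT. Qed.

(* The index 1 in GLrepr stands for dimension 2; SL2 acts by right
   multiplication on row vectors. *)
Definition SL2_natural := subg_repr (GLrepr F 1) SL2_sub_GL2.

Definition ASL2_type : finGroupType := sdprod_by ('MR SL2_natural)%gact.

Definition ASL2 : {group ASL2_type} := [set: ASL2_type]%G.

Definition ASL2_V : {group ASL2_type} :=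
  (sdpair1 ('MR SL2_natural)%gact @* [set: 'rV[F]_2])%G.

Lemma ASL2_V_normal : ASL2_V <| ASL2.
Proof. by have /sdprod_context[] := sdprod_sdpair ('MR SL2_natural)%gact. Qed.

Definition ASL2_crown_square : {group ASL2_type * ASL2_type} :=
  crown_square_group ASL2_V_normal.

End AffineSpecialLinear.

(* Main.v *)
(** The group G is V^2 : SL_2(4).  An element (u_1, u_2) of V^2 with u_1, u_2
    linearly independent, together with lifts of elements of orders 3 and 5 of
    SL_2(4), invariably generates G: a subgroup of SL_2(4) of order divisible
    by 15 contains every element of order 5 by a product count, and these
    generate SL_2(4), while V^2, viewed as 2 x 2 matrices, is generated by any
    invertible matrix as an additive group with SL_2(4) acting on the right.

    Conversely, since H^1(SL_2(4), V) <> 0, there is a 5-dimensional space of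
    derivations from G to V: the two projections of V^2, the two inner ones
    coming from V, and delta.  Vanishing on two given elements of G amounts to 4
    linear conditions, so some nonzero derivation does so; its kernel is a
    proper subgroup containing both elements.

    The diagonal subgroup of L^2 has the exponent of L, hence that of G. *)

Require Import Defs.
From mathcomp Require Import all_boot all_order all_algebra.
From mathcomp Require Import all_fingroup all_solvable all_field all_character.
From mathcomp Require Import ring.

Set Implicit Arguments.
Unset Strict Implicit.
Unset Printing Implicit Defensive.

Import GRing.Theory.
Local Open Scope group_scope.

(** * Explicit 2 x 2 matrices *)

Section TwoByTwo.

Variable R : comNzRingType.
Local Open Scope ring_scope.

Definition mx2 (a b c d : R) : 'M[R]_2 :=
  \matrix_(i, j) if i == 0 then if j == 0 then a else b
                 else if j == 0 then c else d.

Lemma ord2_case (P : 'I_2 -> Prop) : P 0 -> P 1 -> forall i, P i.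
Proof.
move=> P0 P1 [[|[|//]] lt_i2].
  by rewrite (_ : Ordinal _ = 0) //; apply: val_inj.
by rewrite (_ : Ordinal _ = 1) //; apply: val_inj.
Qed.

Lemma big_ord2 (V : nmodType) (f : 'I_2 -> V) : \sum_i f i = f 0 + f 1.
Proof.
rewrite !big_ord_recl big_ord0 addr0; congr (f _ + f _); exact: val_inj.
Qed.

Lemma mx2_eta (A : 'M[R]_2) : A = mx2 (A 0 0) (A 0 1) (A 1 0) (A 1 1).
Proof.
by apply/matrixP; elim/ord2_case; elim/ord2_case; rewrite mxE.
Qed.

Lemma mx2_1 : 1%:M = mx2 1 0 0 1.
Proof. by rewrite [LHS]mx2_eta !mxE. Qed.

Lemma mx2D a b c d a' b' c' d' :
  mx2 a b c d + mx2 a' b' c' d' = mx2 (a + a') (b + b') (c + c') (d + d').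
Proof. by rewrite [LHS]mx2_eta !mxE. Qed.

Lemma mx2M a b c d a' b' c' d' : mx2 a b c d *m mx2 a' b' c' d' =
  mx2 (a * a' + b * c') (a * b' + b * d') (c * a' + d * c') (c * b' + d * d').
Proof. by rewrite [LHS]mx2_eta !mxE !big_ord2 !mxE. Qed.

Lemma det_mx2 a b c d : \det (mx2 a b c d) = a * d - b * c.
Proof.
rewrite (expand_det_row _ 0) big_ord2 /cofactor !det_mx11 !mxE /=.
by rewrite expr0 expr1 mul1r mulN1r mulrN.
Qed.

End TwoByTwo.

(** * Arithmetic in the field of four elements *)

Section FieldOfFour.

Variables (F : finFieldType) (F4 : #|F| = 4%N).
Implicit Type x : F.
Local Open Scope ring_scope.

Lemma F4_expr4 x : x ^+ 4 = x.
Proof. by rewrite -F4 expf_card. Qed.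

Lemma F4_two : 1 + 1 = 0 :> F.
Proof.
(* At x = -1, the equation x^4 = x reads 1 = -1. *)
have := F4_expr4 (-1); rewrite !exprS expr0 !(mulN1r, opprK, mulr1) => {2}->.
exact: addrN.
Qed.

Lemma F4_addrr x : x + x = 0.
Proof. by rewrite -[x]mul1r -mulrDl F4_two mul0r. Qed.

Lemma F4_omega : exists w : F, w ^+ 2 = w + 1.
Proof.
have /card_gt0P[w]: (0 < #|~: [set 0; 1 : F]%R|)%N.
  have := cardsC [set 0; 1 : F]; rewrite F4 cards2 eq_sym oner_neq0 => e.
  by rewrite -(ltn_add2l 2) e.
rewrite !inE negb_or => /andP[w0 w1]; exists w.
(* The product is the factorization of w^4 - w. *)
have: w * (w - 1) * (w ^+ 2 + w + 1) = 0.
  by transitivity (w ^+ 4 - w); [ring | rewrite F4_expr4 subrr].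
move/eqP; rewrite !mulf_eq0 (negPf w0) subr_eq0 (negPf w1) /= => /eqP e.
have := F4_addrr (w + 1); rewrite -{1}e => e2.
apply: (addIr (w + 1)); rewrite F4_addrr -e; ring.
Qed.

Lemma F4_omega3 (w : F) : w ^+ 2 = w + 1 -> w ^+ 3 = 1.
Proof.
move=> w2; transitivity (w * w ^+ 2); first ring.
rewrite w2 mulrDr mulr1 -expr2 w2 -[RHS]add0r -(F4_addrr w); ring.
Qed.

Lemma F4_omega_neq0 (w : F) : w ^+ 2 = w + 1 -> w != 0.
Proof. by apply: contra_eq_neq => ->; rewrite expr0n add0r eq_sym oner_eq0. Qed.

Lemma F4_omega_neq1 (w : F) : w ^+ 2 = w + 1 -> w != 1.
Proof. by apply: contra_eq_neq => ->; rewrite expr1n F4_two oner_eq0. Qed.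

End FieldOfFour.

(** * Affine coordinates on L *)

Section AffineCoordinates.

Variable F : finFieldType.
Local Open Scope ring_scope.
Local Notation L := (ASL2_type F).
Implicit Types u v : L.

(** An element u stands for the affine map x |-> x [lin u] + [trans u], products being composed from
    left to right. *)
Definition lin u : 'M[F]_2 := GLval (pair_of_sd u).1.
Definition trans u : 'rV[F]_2 := (pair_of_sd u).2.

Lemma lin1 : lin 1%g = (1%:M)%R. Proof. by []. Qed.
Lemma trans1 : trans 1%g = 0%R. Proof. by []. Qed.
Lemma linM u v : lin (u * v)%g = lin u *m lin v. Proof. by []. Qed.

Lemma transM u v : trans (u * v)%g = (trans u *m lin v + trans v)%R.
Proof.
rewrite /trans /lin; case: u v => [[a x] /= ?] [[b y] /= /setXP[SLb _]].
by rewrite (mx_repr_actE (SL2_natural F)).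
Qed.

Lemma det_lin u : (\det (lin u) = 1)%R.
Proof.
by case: u => [[a x] /= ax]; move: ax; rewrite /lin /= !inE => /andP[/eqP].
Qed.

Lemma affine_inj u v : trans u = trans v -> lin u = lin v -> u = v.
Proof.
case: u v => [[a x] /= ax] [[b y] /= bY]; rewrite /trans /lin /= => exy eab.
by apply: val_inj; congr pair => //=; apply: val_inj.
Qed.

Lemma affine_exists (x : 'rV[F]_2) (A : 'M[F]_2) :
  (\det A = 1)%R -> exists2 u, trans u = x & lin u = A.
Proof.
move=> detA; have uA : A \in unitmx by rewrite unitmxE detA unitr1.
pose a : {'GL_2[F]} := Sub A uA.
have aS : (a, x) \in setX (SL2_group F) [set: 'rV[F]_2].
  by rewrite !inE andbT; apply/eqP.
by exists (SdPair ('MR (SL2_natural F))%gact aS).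
Qed.

Lemma mem_ASL2_V u : (u \in ASL2_V F) = (lin u == 1%:M%R).
Proof.
apply/idP/eqP => [/morphimP[x _ _ ->] | lu1].
  by rewrite /lin /= val_insubd; case: ifP.
suff ->: u = sdpair1 ('MR (SL2_natural F))%gact (trans u).
  by apply: mem_morphim; rewrite inE.
by apply: affine_inj;
  rewrite /lin /trans /= val_insubd in_setX group1 in_setT.
Qed.

Lemma mem_crown (g : L * L) :
  (g \in ASL2_crown_square F) = (lin g.1 == lin g.2).
Proof.
have eV: (g.1 *: ASL2_V F == g.2 *: ASL2_V F)%g = (lin g.1 == lin g.2).
  rewrite (sameP eqP lcoset_eqP) mem_lcoset mem_ASL2_V.
  apply/eqP/eqP => [e | e]; last by rewrite linM e -linM mulVg.
  by rewrite -[RHS]mulmx1 -e -linM mulKVg.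
by rewrite !inE /= eV.
Qed.
End AffineCoordinates.

(** Elementary transvections generate SL_2: a matrix with nonzero lower left entry is a product
    upper, lower, upper; otherwise adding the first row to the second makes that entry nonzero. *)
Lemma SL2_ind (F : fieldType) (P : 'M[F]_2 -> Prop) :
  (forall A B, P A -> P B -> P (A *m B)%R) ->
  (forall x, P (mx2 1 x 0 1)%R) -> (forall y, P (mx2 1 0 y 1)%R) ->
  forall A, (\det A = 1)%R -> P A.
Proof.
move=> PM PU PL A; rewrite [A]mx2_eta; move: (A 0 0)%R (A 0 1)%R (A 1 0)%R (A 1 1)%R.
have Pc (p q r s : F) : (r != 0 -> p * s - q * r = 1 -> P (mx2 p q r s))%R.
  move=> r0 d1.
  have -> : (mx2 p q r s = mx2 1 ((p - 1) / r) 0 1 *m mx2 1 0 r 1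
                           *m mx2 1 ((s - 1) / r) 0 1)%R.
    have -> : (q = (p * s - 1) / r)%R by rewrite -d1; field.
    by rewrite !mx2M; congr mx2; field.
  by apply/PM/PU/PM.
move=> p q r s; rewrite det_mx2 => d1.
have [r0|] := eqVneq r 0%R; last by move/Pc; apply.
have -> : (mx2 p q r s = mx2 1 0 (-1) 1 *m mx2 p q (p + r) (q + s))%R.
  by rewrite mx2M; congr mx2; ring.
apply: (PM _ _ (PL _)); apply: Pc; last by rewrite -d1; ring.
apply/eqP => p0; move: d1; rewrite r0 addr0 in p0 *.
by rewrite p0 mul0r mulr0 subrr => /esym/eqP; rewrite oner_eq0.
Qed.

(** * Subgroups of SL_2(4) of order divisible by 15 *)

Section SL2OfFour.

Variables (F : finFieldType) (F4 : #|F| = 4%N).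
Local Notation S := (SL2_group F).

Lemma SL2_exists (A : 'M[F]_2) :
  (\det A = 1)%R -> exists2 a, a \in S & GLval a = A.
Proof.
move=> detA; have uA : (A \in unitmx)%R by rewrite unitmxE detA unitr1.
by exists (Sub A uA : {'GL_2[F]}); rewrite // inE; apply/eqP.
Qed.

(* The scalar matrices of determinant other than 1 generate a complement. *)
Lemma card_SL2_F4 : #|S| <= 60.
Proof.
have [w w2] := F4_omega F4.
have w3 := F4_omega3 F4 w2; have w0 := F4_omega_neq0 w2.
have w1 : (w ^+ 2 != 1)%R.
  by rewrite w2 -subr_eq0 addrK.
have uZ : (w%:M \in @unitmx F 2)%R by rewrite unitmxE det_scalar unitfE expf_neq0.
pose z : {'GL_2[F]} := Sub (w%:M)%R uZ.
have zX n : GLval (z ^+ n) = ((w ^+ n)%:M)%R.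
  elim: n => [|n IHn]; first by rewrite expr0.
  by rewrite expgS GL_ME IHn exprS scalar_mxM.
have o_z : #[z] = 3.
  apply: nt_prime_order => //; first by apply: val_inj; rewrite [LHS]zX w3.
  apply/eqP => /(congr1 (fun a : {'GL_2[F]} => \det (GLval a))%R).
  by rewrite GL_1E det1 /= det_scalar => /eqP; rewrite (negPf w1).
have TI : <[z]> :&: S = 1.
  apply: prime_TIg; rewrite -?orderE ?o_z // cycle_subG inE /= det_scalar.
  exact: w1.
have := mul_cardG <[z]> S; rewrite TI cards1 muln1 -orderE o_z => e.
have := subset_leq_card (subsetT (<[z]> * S)).
(* The product set has 3 |S| elements, and |GL_2(4)| = 180. *)
by rewrite -e -/(GLgroup 2 F) card_GL_2 F4
  -[X in _ <= X -> _]/(3 * 60)%N leq_pmul2l.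
Qed.

(** Determinant -1 = 1 and trace t; the order is 5 when t^2 = t + 1. *)
Definition order5_mx (x t : F) : 'M[F]_2 := mx2 0 x x^-1 t.

Lemma det_order5_mx x t : (x != 0 -> \det (order5_mx x t) = 1)%R.
Proof.
move=> x0; rewrite det_mx2 mul0r sub0r divff //.
by apply/eqP; rewrite eq_sym -subr_eq0 opprK F4_two.
Qed.

(* The characteristic polynomial X^2 + t X + 1 divides X^5 - 1. *)
Lemma order5_mxX5 x t (a : {'GL_2[F]}) :
  x != 0%R -> (t ^+ 2 = t + 1)%R -> GLval a = order5_mx x t -> a ^+ 5 = 1.
Proof.
move=> x0 t2 aE; apply: val_inj; transitivity (1%:M : 'M[F]_2)%R; last by [].
have two := F4_two F4.
rewrite mx2_1 expgS (expgM a 2 2) !expgS expg0 !mulg1 [LHS]GL_MxE !GL_MxE aE /order5_mx.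
rewrite !mx2M !(mul0r, mulr0, add0r, addr0) divff // mulVf // -expr2.
(* Each entry is correct modulo t^2 - t - 1 and 2; p and q are the cofactors that turn it into an
   identity for [field]. *)
have red (p q r : F) : (r + (t ^+ 2 - (t + 1)) * p + (1 + 1) * q = r)%R.
  by rewrite t2 subrr two !mul0r !addr0.
congr mx2.
- by rewrite -[RHS](red (t + 1) (t + t))%R; field.
- rewrite -[RHS](red (x * (t ^+ 2 + t + 5%:R)) (x * (3%:R * t + 3%:R)))%R.
  by field.
- rewrite -[RHS](red (x^-1 * (t ^+ 2 + t + 5%:R)) (x^-1 * (3%:R * t + 3%:R)))%R.
  by field.
- rewrite -[RHS](red (t ^+ 3 + t ^+ 2 + 6%:R * t + 7%:R) (8%:R * t + 3%:R))%R.
  by field.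
Qed.

Lemma SL2_sub_of_15 (K : {group {'GL_2[F]}}) :
  K \subset S -> 15 %| #|K| -> S \subset K.
Proof.
move=> sKS K15.
have KP a : a \in S -> a ^+ 5 = 1 -> a \in K.
  move=> Sa a5; have [-> //|na] := eqVneq a 1.
  have o_a : #[a] = 5 by apply: nt_prime_order.
  apply: contraT; rewrite -cycle_subG => /prime_TIg; rewrite -orderE o_a => /(_ isT) TI.
  have sP : <[a]> * K \subset S by rewrite mul_subG // cycle_subG.
  have := mul_cardG <[a]> K; rewrite TI cards1 muln1 -orderE o_a => e.
  have := leq_trans (subset_leq_card sP) card_SL2_F4; rewrite -e.
  (* An element of order 5 outside K would give at least 75 products in S, which has at most 60
     elements. *)
  rewrite leqNgt (@leq_trans (5 * 15)) // leq_pmul2l //.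
  by apply: dvdn_leq.
have [w w2] := F4_omega F4.
(* Both w and w + 1 are admissible traces; two such matrices with the same x differ by a
   transvection factor, which therefore lies in K. *)
have w2' : ((w + 1) ^+ 2 = w + 1 + 1)%R.
  transitivity (w ^+ 2 + (w + w) + 1)%R; first ring.
  by rewrite F4_addrr // addr0 w2.
have K5 x t : x != 0%R -> (t ^+ 2 = t + 1)%R ->
    exists2 a, a \in K & GLval a = order5_mx x t.
  move=> x0 t2; have [a Sa aE] := SL2_exists (det_order5_mx t x0).
  by exists a => //; apply/KP/(order5_mxX5 x0 t2).
suff KA (A : 'M[F]_2) : (\det A = 1)%R -> exists2 a, a \in K & GLval a = A.
  apply/subsetP => a; rewrite inE => /eqP/KA[b Kb ebA].
  by rewrite -(_ : b = a) //; apply: val_inj.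
move: A; apply: SL2_ind => [A B [a Ka <-] [b Kb <-]|x|x].
- by exists (a * b); rewrite ?groupM.
- have [->|x0] := eqVneq x 0%R; first by exists 1; rewrite // -mx2_1.
  have [a Ka aE] := K5 _ _ x0 w2; have [b Kb bE] := K5 _ _ x0 w2'.
  exists (a^-1 * b); first by rewrite groupM ?groupV.
  rewrite GL_MxE GL_VxE (_ : GLval b = GLval a *m mx2 1 x 0 1)%R.
    by rewrite mulKmx ?GL_unitmx.
  rewrite aE bE mx2M !(mul0r, mulr0, mulr1, add0r, addr0) mulVf //.
  by rewrite addrC.
have [->|x0] := eqVneq x 0%R; first by exists 1; rewrite // -mx2_1.
have xV0 : (x^-1 != 0)%R by rewrite invr_eq0.
have [a Ka aE] := K5 _ _ xV0 w2; have [b Kb bE] := K5 _ _ xV0 w2'.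
exists (b * a^-1); first by rewrite groupM ?groupV.
rewrite GL_MxE GL_VxE (_ : GLval b = mx2 1 0 x 1 *m GLval a)%R.
  by rewrite mulmxK ?GL_unitmx.
rewrite aE bE mx2M invrK !(mul0r, mulr0, mul1r, add0r, addr0) divff //.
by rewrite addrC /order5_mx invrK.
Qed.

End SL2OfFour.

(** * Coordinates on G and a generation criterion *)

Section CrownSquare.

Variables (F : finFieldType) (F4 : #|F| = 4%N).
Local Notation L := (ASL2_type F).
Local Notation G := (ASL2_crown_square F).
Local Notation S := (SL2_group F).
Implicit Types g h k : L * L.

Lemma crown_lin g : g \in G -> lin g.2 = lin g.1.
Proof. by rewrite mem_crown => /eqP. Qed.

(** V^2 is encoded as 2 x 2 matrices, one row per factor, so that the common linear part acts by
    right multiplication. *)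
Definition shift g : 'M[F]_2 := col_mx (trans g.1) (trans g.2).

Lemma shiftM g h : h \in G -> shift (g * h) = (shift g *m lin h.1 + shift h)%R.
Proof.
move=> Gh; rewrite /shift !transM (crown_lin Gh).
by rewrite -(@add_col_mx _ 1 1) -(@mul_col_mx _ 1 1).
Qed.

Lemma shift1 : shift 1 = 0%R.
Proof. by rewrite /shift trans1 col_mx0. Qed.

Lemma crown_inj g h : g \in G -> h \in G -> shift g = shift h ->
  lin g.1 = lin h.1 -> g = h.
Proof.
move=> Gg Gh /(@eq_col_mx _ 1 1)[e1 e2] el.
case: g h Gg Gh e1 e2 el => [a b] [c d] /crown_lin/= lb /crown_lin/= ld.
by move=> e1 e2 el; congr pair; apply: affine_inj; rewrite // lb ld.
Qed.

Lemma crown_exists (X A : 'M[F]_2) : (\det A = 1)%R ->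
  exists2 g, g \in G & shift g = X /\ lin g.1 = A.
Proof.
move=> dA; have [a ea aA] := affine_exists (@usubmx _ 1 1 _ X) dA.
have [b eb bA] := affine_exists (@dsubmx _ 1 1 _ X) dA.
exists (a, b); first by rewrite mem_crown aA bA.
by split=> //; rewrite /shift /= ea eb (@vsubmxK _ 1 1).
Qed.

Definition linear_part g : {'GL_2[F]} := (pair_of_sd g.1).1.

Lemma linear_partM : {in [set: L * L] &, {morph linear_part : g h / g * h}}.
Proof. by []. Qed.

Canonical linear_part_morphism := Morphism linear_partM.

Lemma linear_part_SL2 g : linear_part g \in S.
Proof. by rewrite inE; apply/eqP; exact: det_lin. Qed.

Lemma linJ1 g k : lin g.1 = (1%:M)%R -> lin (g ^ k).1 = (1%:M)%R.
Proof.
by move=> lg; rewrite [lin _]linM [lin (_ * _)]linM lg mul1mx -linM mulVg.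
Qed.

Lemma shiftJ1 g k : g \in G -> k \in G -> lin g.1 = (1%:M)%R ->
  shift (g ^ k) = (shift g *m lin k.1)%R.
Proof.
move=> Gg Gk lg; have := shiftM k^-1 Gk; rewrite mulVg shift1 => e.
rewrite conjgE shiftM ?groupM // shiftM // [lin _]linM lg mul1mx.
by rewrite addrCA -e addr0.
Qed.

(* The translations in K form an additive group of 2 x 2 matrices, stable under
   right multiplication by SL_2(4); once it contains one invertible matrix of
   determinant 1 it contains SL_2(4), whose additive span is everything. *)
Lemma crown_generated (K : {group L * L}) g0 :
  K \subset G -> S \subset linear_part @* K ->
  g0 \in K -> lin g0.1 = (1%:M)%R -> (\det (shift g0) = 1)%R -> K :=: G.
Proof.
move=> sKG sSK Kg0 lg0 dg0; have KG := subsetP sKG.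
have lift a : a \in S -> exists2 k, k \in K & linear_part k = a.
  by move/(subsetP sSK)/morphimP => [k _ Kk ->]; exists k.
pose T X := exists2 g, g \in K & lin g.1 = (1%:M)%R /\ shift g = X.
have TD X Y : T X -> T Y -> T (X + Y)%R.
  move=> [g Kg [lg <-]] [h Kh [lh <-]]; exists (g * h); first exact: groupM.
  by rewrite shiftM ?KG // [lin _]linM lg lh !mulmx1.
have TM X A : T X -> (\det A = 1)%R -> T (X *m A)%R.
  move=> [g Kg [lg <-]] /SL2_exists[a /lift[k Kk <-] <-].
  exists (g ^ k); first exact: groupJ.
  by rewrite linJ1 // shiftJ1 ?KG.
have TS A : (\det A = 1)%R -> T A.
  move=> dA; rewrite -[A](@mulKVmx _ _ _ (shift g0)) ?unitmxE ?dg0 ?unitr1 //.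
  by apply: TM; [exists g0 | rewrite det_mulmx det_inv dg0 invr1 mul1r].
have TT X : T X.
  rewrite [X]mx2_eta; move: (X 0 0)%R (X 0 1)%R (X 1 0)%R (X 1 1)%R => a b c d.
  (* Modulo 2, the first two summands produce the diagonal a, d, the next two cancel the a + d left
     in the upper right corner, and the last two supply b and c. All six have determinant 1. *)
  have -> : (mx2 a b c d =
      mx2 (1 + a) a 1 1 + mx2 1 d 1 (1 + d) + (mx2 1 a 0 1 + mx2 1 d 0 1)
      + (mx2 1 b 0 1 + mx2 1 0 c 1))%R.
    have red p q : (q + (1 + 1) * p = q :> F)%R by rewrite F4_two // mul0r addr0.
    rewrite !mx2D; congr mx2.
    - by rewrite -[LHS](red 3%:R)%R; ring.
    - by rewrite -[LHS](red (a + d))%R; ring.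
    - by rewrite -[LHS](red 1)%R; ring.
    - by rewrite -[LHS](red 3%:R)%R; ring.
  by apply/TD; [apply/TD|]; apply/TD; apply/TS; rewrite det_mx2; ring.
apply/eqP; rewrite eqEsubset sKG; apply/subsetP => g Gg.
(* An element k of K with the linear part of g makes g k^-1 a translation, hence an element of K. *)
have [k Kk ek] := lift _ (linear_part_SL2 g).
have Gh : g * k^-1 \in G by rewrite groupM ?groupV // KG.
have [h Kh [lh sh]] := TT (shift (g * k^-1)).
rewrite -(mulgKV k g) groupM // -(crown_inj (KG _ Kh) Gh sh) // lh.
by rewrite -[LHS]/(lin 1) -(mulgV k.1) !linM; congr mulmx; rewrite /lin [_.1]ek.
Qed.

(** * Invariable generators of coprime orders *)

Lemma order_shift0 p g : g \in G -> shift g = 0%R -> prime p ->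
  linear_part g ^+ p = 1 -> linear_part g != 1 -> #[g] = p.
Proof.
move=> Gg sg0 p_pr ap1 a1; apply: nt_prime_order => //; last first.
  by apply: contraNneq a1 => ->.
(* Powers of g keep zero shift, so they are determined by their linear parts. *)
have sX n : shift (g ^+ n) = 0%R.
  elim: n => [|n IHn]; rewrite ?expg0 ?shift1 //.
  by rewrite expgSr shiftM // IHn sg0 mul0mx addr0.
apply: crown_inj; rewrite ?groupX ?shift1 ?sX //.
have := morphX linear_part_morphism p (in_setT g); rewrite /= ap1.
exact: congr1.
Qed.

(** The generators have orders 2, 3 and 5; the bound on #|A| later yields d(G) <= 3. *)
Lemma crown_invariable_generators : exists A : {set L * L},
  [/\ #|A| <= 3, invariably_generates G A &
      {in A &, forall g h, g != h -> coprime #[g] #[h]}].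
Proof.
have [w w2] := F4_omega F4.
have w3 := F4_omega3 F4 w2; have w1 := F4_omega_neq1 F4 w2.
(* Here w + 1 = w^2 is the inverse of w, so the matrix has order 3. *)
have dy : (\det (mx2 w 0 0 (w + 1)) = 1)%R.
  by rewrite det_mx2 mul0r subr0 -w2 -w3; ring.
have [t Gt [st lt]] := crown_exists 1%:M%R (det1 _ _).
have [y Gy [sy ly]] := crown_exists 0%R dy.
have [z Gz [sz lz]] := crown_exists 0%R (det_order5_mx F4 w (oner_neq0 F)).
have o_t : #[t] = 2.
  apply: nt_prime_order => //.
    apply: crown_inj; rewrite ?groupX // expgS expg1.
      rewrite shiftM // lt mulmx1 st shift1 -mulr2n -scaler_nat.
      by rewrite mulr2n F4_two // scale0r.
    by rewrite [lin _]linM lt mul1mx.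
  apply: contraTneq isT => t1; move: st; rewrite t1 shift1 => /matrixP/(_ 0 0)%R.
  by rewrite !mxE => /esym/eqP; rewrite oner_eq0.
have ay3 : linear_part y ^+ 3 = 1.
  apply: val_inj; transitivity (1%:M : 'M[F]_2)%R; last by [].
  rewrite !expgS expg0 mulg1 [LHS]GL_MxE GL_MxE [GLval _]ly mx2_1.
  rewrite !mx2M !(mul0r, mulr0, add0r, addr0) -w2.
  by congr mx2; [rewrite -[RHS]w3 | rewrite -[RHS]mulr1 -w3]; ring.
have ay1 : linear_part y != 1.
  apply: contraNneq w1 => a1; move: ly; rewrite /lin [_.1]a1 => /matrixP/(_ 0 0)%R.
  by rewrite [RHS]mxE /= => <-; rewrite mxE.
have az5 : linear_part z ^+ 5 = 1 by apply: (order5_mxX5 F4 (oner_neq0 F) w2).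
have az1 : linear_part z != 1.
  apply: contraTneq isT => a1; move: lz; rewrite /lin [_.1]a1 => /matrixP/(_ 0 0)%R.
  by rewrite [RHS]mxE GL_1E mxE => /eqP; rewrite oner_eq0.
have o_y : #[y] = 3 by apply: order_shift0.
have o_z : #[z] = 5 by apply: order_shift0.
exists [set t; y; z]; split.
- by rewrite -setUA cardsU1 cards2; case: (t \notin _); case: (y != z).
- have sAG : [set t; y; z] \subset G.
    by apply/subsetP => g /setUP[/set2P[]|/set1P] ->.
  split=> // x xG; set B := [set _ | _ in _].
  have BA g : g \in [set t; y; z] -> g ^ x g \in <<B>>.
    by move=> Ag; apply/mem_gen/imset_f.
  have At : t \in [set t; y; z] by rewrite !inE eqxx.
  have Ay : y \in [set t; y; z] by rewrite !inE eqxx orbT.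
  have Az : z \in [set t; y; z] by rewrite !inE eqxx !orbT.
  (* Conjugation preserves the order of the linear part, so 3 and 5 survive as divisors. *)
  have oB g : g \in [set t; y; z] -> #[linear_part g] %| #|linear_part @* <<B>>|.
    move=> Ag; rewrite -(orderJ _ (linear_part (x g))); apply: order_dvdG.
    rewrite -[_ ^ _]/(linear_part (g ^ x g)).
    by apply: mem_morphim; rewrite ?inE ?BA.
  apply: (crown_generated _ _ (BA t At)).
  - rewrite gen_subG; apply/subsetP => _ /imsetP[g Ag ->].
    by rewrite groupJ ?xG // (subsetP sAG).
  - apply: SL2_sub_of_15 => //.
      by apply/subsetP => _ /morphimP[g _ _ ->]; apply: linear_part_SL2.
    rewrite (@Gauss_dvd 3 5) // -{1}(nt_prime_order _ ay3 ay1) //.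
    by rewrite -(nt_prime_order _ az5 az1) // !oB.
  - exact: linJ1.
  (* The conjugate of t by k has shift [lin k.1], of determinant 1. *)
  by rewrite shiftJ1 ?xG // st mul1mx det_lin.
by move=> g h; rewrite !inE => /orP[/orP[]|] /eqP-> /orP[/orP[]|] /eqP->;
  rewrite ?eqxx // ?o_t ?o_y ?o_z.
Qed.

(** * Derivations and the bound d(G) > 2 *)

Lemma deltaM_entry (a b c d e f : F) : (a * d - b * c = 1 ->
  ((a * e + b * f) * (c * e + d * f)) ^+ 2 =
  (a * c) ^+ 2 * e + (b * d) ^+ 2 * f + (e * f) ^+ 2)%R.
Proof.
move=> dA; rewrite -{3}[e](F4_expr4 F4) -{3}[f](F4_expr4 F4).
transitivity ((a * c) ^+ 2 * e ^+ 4 + (b * d) ^+ 2 * f ^+ 4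
  + (a * d - b * c) ^+ 2 * (e * f) ^+ 2
  + (1 + 1) * ((1 + 1) * (a * d - b * c) * b * c * (e * f) ^+ 2
    + (1 + 1) * (b * c * e * f) ^+ 2 + a * b * c * d * (e * f) ^+ 2
    + (a * d + b * c) * e * f * (a * c * e ^+ 2 + b * d * f ^+ 2)))%R; first ring.
by rewrite dA F4_two // mul0r addr0 expr1n mul1r.
Qed.

Definition delta (A : 'M[F]_2) : 'rV[F]_2 := (\row_j (A 0 j * A 1 j) ^+ 2)%R.

(* The map A |-> (Q(A u) - Q(u))^(1/2), with Q(u) = u_0 u_1, is F-linear in u
   and x^(1/2) = x^2 in F; delta A is its coordinate row. *)
Lemma deltaM (A B : 'M[F]_2) : (\det A = 1)%R ->
  delta (A *m B)%R = (delta A *m B + delta B)%R.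
Proof.
rewrite {1}[A]mx2_eta det_mx2 => dA.
by apply/rowP => j; rewrite !mxE !big_ord2 !mxE; apply: deltaM_entry.
Qed.

(** The five rows are the values at g of the two projections, two inner derivations and [delta]; a
    row vector q on the left forms their linear combinations. *)
Definition derivations g : 'M[F]_(2 + (2 + 1), 2) :=
  col_mx (shift g) (col_mx (lin g.1 - 1%:M)%R (delta (lin g.1))).

Lemma derivationsM g h : h \in G ->
  derivations (g * h) = (derivations g *m lin h.1 + derivations h)%R.
Proof.
move=> Gh; rewrite /derivations shiftM // [lin (g * h).1]linM deltaM ?det_lin //.
rewrite !mul_col_mx !add_col_mx; do 2!congr col_mx.
by rewrite mulmxBl mul1mx addrA subrK.
Qed.

Lemma derivations1 : derivations 1 = 0%R.
Proof.
rewrite /derivations shift1 lin1 subrr (_ : delta _ = 0)%R ?col_mx0 //.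
apply/rowP; elim/ord2_case; rewrite !mxE /= ?mulr0 ?mul0r expr0n //.
Qed.

(** Independence is tested on three elements: a translation isolates q1; a diagonal matrix, where
    [delta] vanishes and A - 1 is invertible, isolates q2; a transvection with nonzero [delta]
    isolates q3. *)
Lemma derivations_free (q : 'rV[F]_(2 + (2 + 1))) :
  (forall g, g \in G -> q *m derivations g = 0)%R -> q = 0%R.
Proof.
move: (lsubmx q) (lsubmx (rsubmx q)) (rsubmx (rsubmx q))
  (hsubmxK (rsubmx q)) (hsubmxK q) => q1 q2 q3 <- <- qD.
have {qD}qE X A : (\det A = 1 ->
    q1 *m X + q2 *m (A - 1%:M) + q3 *m delta A = 0)%R.
  move=> dA; have [g Gg [sg lg]] := crown_exists X dA.
  by have := qD g Gg; rewrite /derivations !mul_row_col sg lg addrA.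
have [w w2] := F4_omega F4.
have w0 := F4_omega_neq0 w2; have w1 := F4_omega_neq1 F4 w2.
have d0 a d : delta (mx2 a 0 0 d) = 0%R.
  by apply/rowP; elim/ord2_case; rewrite !mxE /= ?mulr0 ?mul0r expr0n.
have q1_0 : q1 = 0%R.
  have := qE 1%:M%R 1%:M%R (det1 _ _).
  by rewrite subrr mulmx0 mulmx1 mx2_1 d0 mulmx0 !addr0.
have q2_0 : q2 = 0%R.
  have dA : (\det (mx2 w 0 0 (w + 1)) = 1)%R.
    by rewrite det_mx2 mul0r subr0 -w2 -(F4_omega3 F4 w2); ring.
  have := qE 0%R _ dA; rewrite q1_0 mul0mx d0 mulmx0 add0r addr0 => e.
  have uA : (mx2 w 0 0 (w + 1) - 1%:M \in unitmx)%R.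
    rewrite unitmxE mx2_1 (_ : _ - _ = mx2 (w - 1) 0 0 w)%R.
      by rewrite det_mx2 mul0r subr0 unitfE mulf_neq0 // subr_eq0.
    by rewrite [LHS]mx2_eta !mxE /= !subr0 addrK.
  by rewrite -[q2](mulmxK uA) e mul0mx.
have q3_0 : q3 = 0%R.
  have dA : (\det (mx2 1 0 1 1 : 'M[F]_2) = 1)%R by rewrite det_mx2; ring.
  have := qE 0%R _ dA; rewrite q1_0 q2_0 !mul0mx !add0r => /rowP/(_ 0)%R.
  rewrite !mxE big_ord_recl big_ord0 !mxE /= mulr1 expr1n mulr1 addr0 => q30.
  by apply/rowP => i; rewrite ord1 q30 mxE.
by rewrite q1_0 q2_0 q3_0 !row_mx0.
Qed.

Lemma crown_2gen g h : <<[set g; h]>> != G :> {set _}.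
Proof.
apply/eqP => gen.
have [q q0 qgh] : exists2 q : 'rV[F]_(2 + (2 + 1)), q != 0%R &
    (q *m row_mx (derivations g) (derivations h) = 0)%R.
  set M := row_mx _ _.
  (* M has 5 rows and only 4 columns. *)
  have : kermx M != 0%R.
    rewrite -mxrank_eq0 mxrank_ker subn_eq0 -ltnNge.
    exact: leq_ltn_trans (rank_leq_col M) _.
  by case/rowV0Pn => q /sub_kermxP qM q0; exists q.
have [qg qh] : (q *m derivations g = 0 /\ q *m derivations h = 0)%R.
  by apply/eq_row_mx; rewrite row_mx0 -mul_mx_row.
(* The zero set of a derivation is a subgroup. *)
pose K := [set k in G | q *m derivations k == 0]%R.
have KE k : (k \in K) = (k \in G) && (q *m derivations k == 0)%R.
  by rewrite in_set.
have gK : group_set K.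
  apply/group_setP; split=> [|a b].
    by rewrite KE group1 derivations1 mulmx0 eqxx.
  rewrite !KE => /andP[Ga /eqP qa] /andP[Gb /eqP qb].
  by rewrite groupM // derivationsM // mulmxDr mulmxA qa qb mul0mx addr0 eqxx.
have sGK : G \subset Group gK.
  rewrite -gen gen_subG; apply/subsetP => k ghk.
  have Gk : k \in G by rewrite -gen mem_gen.
  by rewrite KE Gk; case/set2P: ghk => ->; rewrite ?qg ?qh eqxx.
case/eqP: q0; apply: derivations_free => k /(subsetP sGK).
by rewrite KE => /andP[_ /eqP].
Qed.

Lemma crown_grank : 'm(G) = 3.
Proof.
apply/eqP; rewrite eqn_leq; apply/andP; split.
  have [A [A3 [sAG genA] _]] := crown_invariable_generators.
  (* Trivial conjugators turn invariable generation into generation. *)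
  have <- : <<A>> = G.
    rewrite -[RHS](genA (fun=> 1) (fun _ _ => group1 G)).
    congr <<_>>; apply/setP => g; apply/idP/imsetP => [Ag | [h Ah ->]].
      by exists g; rewrite ?conjg1.
    by rewrite conjg1.
  exact: leq_trans (grank_min A) A3.
have [B genB <-] := grank_witness G; rewrite ltnNge; apply/negP => B2.
(* A generating set with fewer than three elements can be padded to a pair, by repetition or by the
   identity. *)
suff [g [h eB]] : exists g h, <<B>> = <<[set g; h]>>.
  by case/eqP: (crown_2gen g h); rewrite -eB.
have [B0|B_gt0] := posnP #|B|.
  by exists 1, 1; rewrite (cards0_eq B0) setUid gen0 genGid.
have [/cards1P[g ->]|B1] := boolP (#|B| == 1%N).
  by exists g, g; rewrite setUid.
have /cards2P[g [h [_ ->]]] : #|B| == 2.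
  by rewrite eqn_leq B2 ltn_neqAle eq_sym B1.
by exists g, h.
Qed.

(** * The diagonal subgroup and the exponent *)

Lemma crown_diagonal : exists H : {group L * L},
  H \proper G /\ exponent H = exponent G.
Proof.
pose D := [set g in G | g.1 == g.2].
have DE g : (g \in D) = (g \in G) && (g.1 == g.2) by rewrite in_set.
have gD : group_set D.
  apply/group_setP; split=> [|a b]; first by rewrite DE group1 eqxx.
  rewrite !DE => /andP[Ga /eqP ea] /andP[Gb /eqP eb].
  by rewrite groupM //=; apply/eqP; congr (_ * _).
have sDG : Group gD \subset G.
  by apply/subsetP => g; rewrite DE => /andP[].
exists (Group gD); split.
  rewrite properE sDG; apply/subsetPn.
  (* A translation that is nontrivial in the first factor only is not diagonal. *)
  have [t Gt [st lt]] := crown_exists (mx2 1 0 0 0)%R (det1 _ 2).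
  exists t; rewrite // DE Gt; apply/eqP => e; move: st; rewrite /shift -e.
  rewrite -[mx2 _ _ _ _](@vsubmxK _ 1 1) => /(@eq_col_mx _ 1 1)[-> /rowP/(_ 0)%R].
  by rewrite !mxE /= => /eqP; rewrite oner_eq0.
apply/eqP; rewrite eqn_dvd exponentS //=; apply/exponentP => g Gg.
have fstX n (k : L * L) : (k ^+ n).1 = k.1 ^+ n.
  by elim: n => [|n IHn]; rewrite ?expg0 // !expgS -IHn.
have sndX n (k : L * L) : (k ^+ n).2 = k.2 ^+ n.
  by elim: n => [|n IHn]; rewrite ?expg0 // !expgS -IHn.
(* Each a in L is a coordinate of (a, a), so the exponent of the diagonal kills both coordinates of
   any g in G. *)
have diagX (a : L) : a ^+ exponent (Group gD) = 1.
  by rewrite -(fstX _ (a, a)) (exponentP (dvdnn _)) // DE mem_crown !eqxx.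
by rewrite [g ^+ _]surjective_pairing fstX sndX !diagX.
Qed.

End CrownSquare.

Theorem proposition3p1 (F : finFieldType) (F4 : #|F| = 4%N) :
  let G := ASL2_crown_square F in
  [/\ coprimely_invariably_generated G,
      'm(G) = 3%N &
      exists H : {group ASL2_type F * ASL2_type F},
        H \proper G /\ exponent H = exponent G].
Proof.
split; first by have [A [_ invA copA]] := crown_invariable_generators F4; exists A.
  exact: crown_grank.
exact: crown_diagonal.
Qed.
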